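(* Let $E=(e_j)_{j\ge0}$ be the sequence defined by $e_k=\exp\big(i\pi\sum_{j=0}^n a_j2^{-j}\big)$ for $k=\sum_{j=0}^n a_j2^j$, $a_j\in\{0,1\}$, or, more generally, any Leja sequence on the closed unit disc $\mathcal{U}$ with $e_0\in\partial\mathcal{U}$. Then $$\mathbb{L}_{E_k}\le 3\sqrt{\frac{k}{2^{p(k)}}\big(2^{\sigma_1(k)}-1\big)}\ \mathbb{L}_{2^{p(k)}},\qquad k\ge1 .$$
   Context: $\mathcal{U}=\{z\in\mathbb{C}:|z|\le 1\}$. A Leja sequence on $\mathcal{U}$ with $e_0\in\partial\mathcal{U}$ is a sequence $(e_j)_{j\ge0}$ such that $e_0\in\partial\mathcal U$ is arbitrary and, for every $k\ge1$, $e_k$ is one of the maximizers over $z\in\mathcal{U}$ of $|z-e_{k-1}|\cdots|z-e_0|$. $E_k=(e_0,\dots,e_{k-1})$. For a finite tuple $S=(s_0,\dots,s_{k-1})$ of mutually distinct points of $\mathcal{U}$, with Lagrange polynomials $l_j(z)=\prod_{0\le i\le k-1,\ i\ne j}\frac{z-s_i}{s_j-s_i}$, the Lebesgue constant of $S$ is $\mathbb{L}_S=\max_{z\in\mathcal{U}}\sum_{j=0}^{k-1}|l_j(z)|$. For $p\ge0$, $\mathbb{L}_{2^p}$ denotes the Lebesgue constant (on $\mathcal{U}$) of the set of $2^p$-th roots of unity. For an integer $k\ge1$, $\sigma_1(k)$ is the number of ones in the binary expansion of $k$, and $p(k)$ is the largest integer $p$ such that $2^p$ divides $k$. *)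

(* Defs.v *)
From mathcomp Require Import all_boot all_order all_algebra.
From mathcomp Require Import all_classical all_reals all_analysis.
From mathcomp Require Import complex.

Set Implicit Arguments.
Unset Strict Implicit.
Unset Printing Implicit Defensive.

Import Order.TTheory GRing.Theory Num.Theory.
Import numFieldNormedType.Exports.
Import ComplexField.Normc.

Local Open Scope classical_set_scope.
Local Open Scope ring_scope.
Local Open Scope complex_scope.

(* The modulus is taken to be [normc : R[i] -> R], the real-valued one; the
   norm [`|z|] of the numFieldType R[i] is [(normc z)%:C]. *)

Definition unit_disc (R : realType) : set R[i] := [set z | normc z <= 1].
Arguments unit_disc : clear implicits.

Definition expi (R : realType) (t : R) : R[i] := cos t +i* sin t.

Definition lagrange_fun (R : realType) (k : nat) (S : 'I_k -> R[i]) (j : 'I_k)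
    (z : R[i]) : R[i] :=
  \prod_(i < k | i != j) ((z - S i) / (S j - S i)).

Definition lebesgue_fun (R : realType) (k : nat) (S : 'I_k -> R[i])
    (z : R[i]) : R :=
  \sum_(j < k) normc (lagrange_fun S j z).

(* The supremum is a maximum: see [lebesgue_const_max] below. *)
Definition lebesgue_const (R : realType) (k : nat) (S : 'I_k -> R[i]) : R :=
  sup [set lebesgue_fun S z | z in unit_disc R].

Definition unity_roots (R : realType) (n : nat) (j : 'I_n) : R[i] :=
  expi (2 * pi * j%:R / n%:R).
Arguments unity_roots : clear implicits.

Definition is_leja (R : realType) (e : nat -> R[i]) : Prop :=
  normc (e 0%N) = 1 /\
  forall k : nat, (0 < k)%N ->
    unit_disc R (e k) /\
    forall z : R[i], unit_disc R z ->
      \prod_(j < k) normc (z - e j) <= \prod_(j < k) normc (e k - e j).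

Definition initial_section (R : realType) (e : nat -> R[i]) (k : nat) :
    'I_k -> R[i] :=
  fun j => e j.
Arguments initial_section {R} e k.

Definition bdigit (k j : nat) : bool := odd (k %/ 2 ^ j).

(* Since k < 2 ^ k, all the nonzero binary digits of k have index below k. *)
Definition sigma1 (k : nat) : nat := (\sum_(j < k) bdigit k j)%N.

Definition bitrev_seq (R : realType) (k : nat) : R[i] :=
  expi (pi * \sum_(j < k) (bdigit k j)%:R / 2 ^+ j).

Lemma bdigit_sum (n : nat) (a : nat -> bool) (i : nat) :
  bdigit (\sum_(j < n) a j * 2 ^ j)%N i = (i < n)%N && a i.
Proof.
elim: n a i => [|n IHn] a i; first by rewrite big_ord0 /bdigit div0n.
rewrite big_ord_recl expn0 muln1.
under eq_bigr do rewrite lift0 expnSr mulnA.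
rewrite -big_distrl /= /bdigit; case: i => [|i].
  by rewrite expn0 divn1 oddD oddM andbF addbF oddb.
have a02 : (a 0 < 2)%N by case: (a 0).
rewrite expnS divnMA addnC divnMDl // (divn_small a02) addn0.
by have := IHn (a \o S) i; rewrite /bdigit /= => ->; rewrite ltnS.
Qed.

Lemma bdigit_small (k j : nat) : (k <= j)%N -> bdigit k j = false.
Proof.
by move=> kj; rewrite /bdigit divn_small // (leq_ltn_trans kj) // ltn_expl.
Qed.

Lemma bitrev_seqE (R : realType) (n : nat) (a : nat -> bool) :
  bitrev_seq R (\sum_(j < n.+1) a j * 2 ^ j)%N =
  expi (pi * \sum_(j < n.+1) (a j)%:R / 2 ^+ j).
Proof.
rewrite /bitrev_seq; set k := (X in bdigit X).
congr (expi (pi * _)); pose m := maxn k n.+1.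
have E (p : nat) : (p <= m)%N -> (forall j, (p <= j)%N -> bdigit k j = false) ->
    \sum_(j < p) (bdigit k j)%:R / 2 ^+ j =
    \sum_(j < m) (bdigit k j)%:R / 2 ^+ j :> R.
  move=> pm p0; rewrite (big_ord_widen _ (fun j => (bdigit k j)%:R / 2 ^+ j) pm).
  rewrite [RHS](bigID (fun j : 'I_m => (j < p)%N)) /= [X in _ + X]big1 ?addr0 //.
  by move=> j; rewrite -leqNgt => /p0 ->; rewrite mul0r.
rewrite (E k) ?leq_maxl //; last by move=> j; exact: bdigit_small.
rewrite -(E n.+1) ?leq_maxr //.
  by apply: eq_bigr => j _; rewrite bdigit_sum ltn_ord.
by move=> j nj; rewrite bdigit_sum ltnNge nj.
Qed.

Lemma normc_prod (R : realType) (I : Type) (r : seq I) (P : pred I)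
    (F : I -> R[i]) :
  normc (\prod_(i <- r | P i) F i) = \prod_(i <- r | P i) normc (F i).
Proof. by elim/big_rec2: _ => [|i x y _ <-]; rewrite ?normc1 ?normcM. Qed.

Lemma continuous_normc_sub (R : realType) (s : R[i]) :
  continuous (fun p : R * R => normc ((p.1 +i* p.2) - s)).
Proof.
case: s => a b p.
apply: (@continuous_comp _ _ _ (fun p : R * R => (p.1 - a) ^+ 2 + (p.2 - b) ^+ 2)
   Num.sqrt); last exact: sqrt_continuous.
have sqr (f : R * R -> R) c : f x @[x --> p] --> f p ->
    (f x - c) ^+ 2 @[x --> p] --> (f p - c) ^+ 2.
  by move=> fp; rewrite expr2; under eq_fun do rewrite expr2;
    apply: cvgM; apply: cvgB => //; exact: cvg_cst.
by apply: cvgD; apply: sqr; [exact: cvg_fst | exact: cvg_snd].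
Qed.

Lemma continuous_bigop (T : topologicalType) (R : realType) (op : R -> R -> R)
    (idx : R) (I : Type) (r : seq I) (P : pred I) (F : I -> T -> R) :
  (forall f g : T -> R, continuous f -> continuous g ->
     continuous (fun p => op (f p) (g p))) ->
  (forall i, continuous (F i)) ->
  continuous (fun p => \big[op/idx]_(i <- r | P i) F i p).
Proof.
move=> cop cF; elim: r => [|i r IHr].
  rewrite (_ : (fun p => _) = fun=> idx); first by move=> p; exact: cvg_cst.
  by apply/funext => p; rewrite big_nil.
rewrite (_ : (fun p => _) = fun p => if P i
    then op (F i p) (\big[op/idx]_(j <- r | P j) F j p)
    else \big[op/idx]_(j <- r | P j) F j p).
  by case: (P i) => //; exact: cop.
by apply/funext => p; rewrite big_cons.
Qed.

Lemma continuous_lebesgue_fun (R : realType) (k : nat) (S : 'I_k -> R[i]) :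
  continuous (fun p : R * R => lebesgue_fun S (p.1 +i* p.2)).
Proof.
apply: continuous_bigop => [f g cf cg p|j]; first exact: cvgD (cf p) (cg p).
rewrite /lagrange_fun; under eq_fun do rewrite normc_prod.
apply: continuous_bigop => [f g cf cg p|i]; first exact: cvgM (cf p) (cg p).
under eq_fun do rewrite normcM.
by move=> p; apply: cvgM; [exact: continuous_normc_sub | exact: cvg_cst].
Qed.

Lemma lebesgue_const_max (R : realType) (k : nat) (S : 'I_k -> R[i]) :
  exists2 z, unit_disc R z & lebesgue_fun S z = lebesgue_const S /\
    forall w, unit_disc R w -> lebesgue_fun S w <= lebesgue_fun S z.
Proof.
pose toC (p : R * R) : R[i] := p.1 +i* p.2; pose D := [set p | normc (toC p) <= 1].
have clD : closed D.
  have -> : D = (fun p => normc (toC p - 0)) @^-1` [set x | x <= 1].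
    by apply/funext => p; rewrite /preimage /D /mkset subr0.
  apply: preimage_closed; last exact: closed_le.
  by move=> p _; exact: continuous_normc_sub.
have coD : compact D.
  have sq := compact_setX (@segment_compact R (-1) 1) (@segment_compact R (-1) 1).
  apply: (subclosed_compact _ sq) => //.
  move=> -[x y]; rewrite /D /= => xy1.
  have xy : x ^+ 2 + y ^+ 2 <= 1.
    by rewrite -ler_sqrt ?ltr01 // sqrtr1.
  by split; rewrite /= in_itv /= -ler_norml -(@expr_le1 _ 2) // real_normK
    ?num_real //; apply: le_trans xy; rewrite ?lerDl ?lerDr sqr_ge0.
have [||c] := @compact_EVT_max _ _ (lebesgue_fun S \o toC) D _ coD.
- by exists (0, 0); rewrite /D /= expr0n /= addr0 sqrtr0.
- exact/continuous_subspaceT/continuous_lebesgue_fun.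
rewrite inE => Dc cmax; have le w : unit_disc R w ->
    lebesgue_fun S w <= lebesgue_fun S (toC c).
  by case: w => x y w1; apply: (cmax (x, y)); rewrite inE.
exists (toC c) => //; split=> //.
apply/eqP; rewrite eq_le; apply/andP; split.
  apply: ub_le_sup; last by exists (toC c).
  by exists (lebesgue_fun S (toC c)) => _ [w w1 <-]; exact: le.
by apply: ge_sup; [exists (lebesgue_fun S (toC c)), (toC c) |
  move=> _ [w w1 <-]; exact: le].
Qed.

(* Main.v *)
Require Import Defs.
From mathcomp Require Import all_boot all_order all_algebra.
From mathcomp Require Import all_classical all_reals all_analysis.
From mathcomp Require Import complex.
From mathcomp Require Import zify ring lra.

(** Leja sequences on the disc are dyadic, and the sum of the squares of the
    Lagrange polynomials is adapted to this structure.

    Let [e] be a Leja sequence.  Then [e (2j+1) = - e (2j)], and the squares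
    [F j = (e (2j)) ^ 2] form a Leja sequence again ([leja_antipodal],
    [leja_halve]); the bit-reversal sequence is Leja because it is antipodal
    and equal to its own [F].  Over the antipodal pairs, the Lagrange
    polynomials of [2N] points of [e] are those of [N] points of [F] at
    [z ^ 2] times [(1 + z / e i) / 2] ([lag_halve]).  By the parallelogram
    identity, the quadratic Lebesgue function [Q_k z], the sum over [j < k] of
    [|l_j z| ^ 2], thus satisfies [Q_2N[e] z <= Q_N[F] (z ^ 2)] on the disc,
    with equality on the circle.  So doubling the number of points costs
    nothing, and only the ones in the binary expansion of [k] matter.

    At the next point of the sequence the value is exact:
    [Q_k (e k) = 2 ^ sigma1 k - 1] ([quad_next]).  Adding the point [e k]
    changes [l_j] by [l_j (e k) * w z / w (e k)], where [w] is the monic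
    polynomial vanishing at the first [k] points, and [|w z / w (e k)| <= 1]
    is the Leja property.  By Minkowski's inequality, [sqrt Q] grows by at most
    [sqrt (Q_k (e k) + 1) = sqrt 2 ^ sigma1 k] ([quad_succ]), and summing the
    geometric series gives
    [sqrt Q_k <= (1 + sqrt 2) (sqrt 2 ^ sigma1 k - 1) <= 3 sqrt (2 ^ sigma1 k - 1)].
    By Cauchy-Schwarz the sum of the [|l_j z|] is at most [sqrt k * sqrt Q_k].

    For [k = 2 ^ p * m] the points of [e] group into [m] blocks of [2 ^ p], each
    a rotation of the [2 ^ p]-th roots of unity; the Lagrange polynomials
    factor along the blocks ([lag_block]), so the Lebesgue constant is at most
    that of [m] points of a Leja sequence times that of the roots of unity.
    Applying the previous bound to [m], for which [sigma1 m = sigma1 k], gives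
    the theorem. *)

Set Implicit Arguments.
Unset Strict Implicit.
Unset Printing Implicit Defensive.

Import Order.TTheory GRing.Theory Num.Theory.
Import ComplexField.Normc.
Local Open Scope ring_scope.

(** * The modulus and finite sums *)

Lemma normc_nat (R : realType) n : normc (n%:R : R[i]) = n%:R.
Proof. by rewrite normcMn normc1. Qed.

Lemma normc_ge0 (R : realType) (z : R[i]) : 0 <= normc z.
Proof. by case: z => a b; exact: sqrtr_ge0. Qed.

Lemma normcX (R : realType) (z : R[i]) n : normc (z ^+ n) = normc z ^+ n.
Proof. by elim: n => [|n IHn]; rewrite ?expr0 ?normc1 // !exprS normcM IHn. Qed.

Lemma normc_eq0 (R : realType) (z : R[i]) : (normc z == 0) = (z == 0).
Proof. by apply/eqP/eqP => [/eq0_normc //|->]; exact: normc0. Qed.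

Lemma sqr_normcE (R : realType) (a b : R) : normc (Complex a b) ^+ 2 = a ^+ 2 + b ^+ 2.
Proof. by rewrite sqr_sqrtr // addr_ge0 ?sqr_ge0. Qed.

Lemma parallelogram (R : realType) (x y : R[i]) :
  normc (x + y) ^+ 2 + normc (x - y) ^+ 2 = 2 * (normc x ^+ 2 + normc y ^+ 2).
Proof. by case: x y => [a b] [c d]; rewrite !sqr_normcE; ring. Qed.

Lemma unit_discX (R : realType) (z : R[i]) n : unit_disc R z -> unit_disc R (z ^+ n).
Proof. by rewrite /unit_disc /= normcX => z1; rewrite exprn_ile1 ?normc_ge0. Qed.

Lemma big_ord_double (T : Type) (idx : T) (op : Monoid.law idx) (F : nat -> T) N :
  \big[op/idx]_(i < N.*2) F i = \big[op/idx]_(i < N) op (F i.*2) (F i.*2.+1).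
Proof.
elim: N => [|N IHN]; first by rewrite !big_ord0.
by rewrite doubleS !big_ord_recr /= IHN Monoid.mulmA.
Qed.

Lemma sum_halves (R : realType) N (F : nat -> R) :
  \sum_(i < N.*2) F i./2 = 2 * \sum_(i < N) F i.
Proof.
rewrite (big_ord_double _ (fun i => F i./2)) mulr_sumr; apply: eq_bigr => i _ /=.
by rewrite uphalf_double doubleK mulr_natl mulr2n.
Qed.

Lemma CauchySchwarz_sum (R : realType) n (a b : 'I_n -> R) :
  (\sum_i a i * b i) ^+ 2 <= (\sum_i a i ^+ 2) * (\sum_i b i ^+ 2).
Proof.
have : 0 <= \sum_i \sum_j (a i * b j - a j * b i) ^+ 2.
  by apply: sumr_ge0 => i _; apply: sumr_ge0 => j _; exact: sqr_ge0.
have -> : \sum_i \sum_j (a i * b j - a j * b i) ^+ 2 =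
  2 * ((\sum_i a i ^+ 2) * (\sum_i b i ^+ 2) - (\sum_i a i * b i) ^+ 2).
  pose X := \sum_i \sum_j (a i ^+ 2 * b j ^+ 2).
  pose Y := \sum_i \sum_j (a i * b i * (a j * b j)).
  have XE : (\sum_i a i ^+ 2) * (\sum_i b i ^+ 2) = X.
    by rewrite mulr_suml; apply: eq_bigr => i _; rewrite mulr_sumr.
  have YE : (\sum_i a i * b i) ^+ 2 = Y.
    by rewrite expr2 mulr_suml; apply: eq_bigr => i _; rewrite mulr_sumr.
  have X'E : X = \sum_i \sum_j (a j ^+ 2 * b i ^+ 2) by rewrite /X exchange_big.
  rewrite XE YE mulrBr mulr_natl mulr2n {2}X'E /X /Y mulr_sumr -big_split -sumrB.
  apply: eq_bigr => i _ /=; rewrite mulr_sumr -big_split -sumrB.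
  by apply: eq_bigr => j _ /=; ring.
by lra.
Qed.

(** Stated with upper bounds [A], [B] for the two norms, so that no square root
    of a sum appears. *)
Lemma Minkowski_sum (R : realType) n (a b : 'I_n -> R) (A B : R) :
  0 <= A -> 0 <= B -> \sum_i a i ^+ 2 <= A ^+ 2 -> \sum_i b i ^+ 2 <= B ^+ 2 ->
  \sum_i (a i + b i) ^+ 2 <= (A + B) ^+ 2.
Proof.
move=> A0 B0 aA bB.
have -> : \sum_i (a i + b i) ^+ 2 =
    \sum_i a i ^+ 2 + 2 * (\sum_i a i * b i) + \sum_i b i ^+ 2.
  rewrite mulr_sumr -!big_split; apply: eq_bigr => i _ /=; ring.
have : \sum_i a i * b i <= A * B.
  apply: le_trans (ler_norm _) _.
  rewrite -(@ler_pXn2r _ 2) ?nnegrE ?mulr_ge0 ?normr_ge0 // real_normK ?num_real //.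
  apply: le_trans (CauchySchwarz_sum a b) _.
  by rewrite exprMn ler_pM ?sumr_ge0 // => i _; exact: sqr_ge0.
by rewrite sqrrD; lra.
Qed.

(** * Antipodal pairs *)

Definition node_poly (R : realType) (e : nat -> R[i]) k z := \prod_(j < k) (z - e j).

(** The Lagrange polynomials of the first [k] points of [e], with a natural
    number as index: for [j = k] this is the ratio of [node_poly e k z] to its
    value at [e k]. *)
Definition lag (R : realType) (e : nat -> R[i]) k j z : R[i] :=
  \prod_(i < k | i != j :> nat) ((z - e i) / (e j - e i)).

Definition halve (R : realType) (e : nat -> R[i]) : nat -> R[i] := fun j => e j.*2 ^+ 2.

Definition antipodal (R : realType) (e : nat -> R[i]) := forall j, e j.*2.+1 = - e j.*2.

(** Each pair [e (2j), - e (2j)] contributes [z ^ 2 - (e (2j)) ^ 2].  The pairs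
    are only assumed below [N], since [next_max_struct] uses this lemma before
    all of them are known to be antipodal. *)
Lemma node_poly_halve (R : realType) (e : nat -> R[i]) N z :
  (forall j, (j < N)%N -> e j.*2.+1 = - e j.*2) ->
  node_poly e N.*2 z = node_poly (halve e) N (z ^+ 2).
Proof.
move=> eN; rewrite /node_poly (big_ord_double _ (fun j => z - e j)).
by apply: eq_bigr => j _ /=; rewrite eN // /halve; ring.
Qed.

(** Every pair of factors other than the one containing [e i] is a factor of the
    halved Lagrange polynomial at [z ^ 2]; in the pair of [e i] only the
    antipode [- e i] remains, with factor [(z + e i) / (2 * e i)]. *)
Lemma lag_halve (R : realType) (e : nat -> R[i]) N i z :
  antipodal e -> e i != 0 -> (i < N.*2)%N ->
  lag e N.*2 i z = lag (halve e) N i./2 (z ^+ 2) * ((1 + z / e i) / 2).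
Proof.
move=> eN ei iN.
have [b [m im]] : exists b : bool, exists m, i = (b + m.*2)%N.
  by exists (odd i), i./2; rewrite odd_double_half.
move: ei iN; rewrite {i}im half_bit_double; set i := (b + m.*2)%N => ei iN.
have mN : (m < N)%N by rewrite /i in iN; lia.
have ei2 : e i ^+ 2 = halve e m.
  by rewrite /halve /i; case: (b); rewrite ?add1n ?add0n ?eN ?sqrrN.
rewrite /lag [LHS]big_mkcond [in RHS]big_mkcond /=.
rewrite (big_ord_double _ (fun j => if j != i then (z - e j) / (e i - e j) else 1)).
rewrite (bigD1 (Ordinal mN)) //= [in RHS](bigD1 (Ordinal mN)) //= eqxx mul1r.
rewrite mulrC; congr (_ * _).
  apply: eq_bigr => j; rewrite -val_eqE /= => ji.
  rewrite !ifT; try by rewrite /i; case: (b); lia.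
  by rewrite eN mulrACA -invfM !opprK -ei2 /halve; congr (_ / _); ring.
have e2 : (2 : R[i]) != 0 by rewrite pnatr_eq0.
move: ei {ei2 iN}; rewrite /i; case: (b); rewrite ?add1n ?add0n eqxx.
  rewrite ifT; last by lia.
  rewrite eN oppr_eq0 => ei.
  have -> : - e m.*2 - e m.*2 = 2 * - e m.*2 by ring.
  by rewrite mulr1; field; rewrite ei.
rewrite ifT; last by lia.
rewrite eN => ei.
have -> : e m.*2 - - e m.*2 = 2 * e m.*2 by ring.
by rewrite mul1r; field; rewrite ei.
Qed.

Lemma unit_disc_sqrtc (R : realType) (z : R[i]) : unit_disc R z -> unit_disc R (sqrtc z).
Proof.
rewrite /unit_disc /= -{1}(sqr_sqrtc z) normcX => z1.
by rewrite -(@expr_le1 _ 2) // normc_ge0.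
Qed.

Lemma node_polyS (R : realType) (e : nat -> R[i]) k z :
  node_poly e k.+1 z = node_poly e k z * (z - e k).
Proof. exact: big_ord_recr. Qed.

(** * Leja sequences *)

(** One step of the Leja condition.  It is kept apart because the structure
    theorem is proved by induction on initial segments, and halving a segment
    does not give a full Leja sequence before antipodality is known. *)
Definition next_max (R : realType) (e : nat -> R[i]) k :=
  unit_disc R (e k) /\
  forall z, unit_disc R z -> normc (node_poly e k z) <= normc (node_poly e k (e k)).

Lemma is_lejaP (R : realType) (e : nat -> R[i]) :
  is_leja e <-> normc (e 0%N) = 1 /\ forall k, next_max e k.
Proof.
split=> [[e0 eM]|[e0 eM]]; split=> // k.
  case: k => [|k].
    by split=> [|z _]; rewrite /unit_disc /= ?e0 // /node_poly !big_ord0.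
  have [ek ekM] := eM k.+1 isT; split=> // z /ekM.
  by rewrite /node_poly !normc_prod.
move=> _; have [ek ekM] := eM k; split=> // z /ekM.
by rewrite /node_poly !normc_prod.
Qed.

(** Every point of the disc is the square of a point of the disc, so maximizing
    [node_poly e (2N)] over [z] is maximizing [node_poly (halve e) N] over
    [z ^ 2]. *)
Lemma next_max_halve (R : realType) (e : nat -> R[i]) N :
  (forall j, (j < N)%N -> e j.*2.+1 = - e j.*2) ->
  next_max e N.*2 -> next_max (halve e) N.
Proof.
move=> eN [e1 eM]; split=> [|z z1]; first exact: unit_discX.
have := eM _ (unit_disc_sqrtc z1).
by rewrite !node_poly_halve // sqr_sqrtc.
Qed.

(** The diameters of the disc are its only chords of length 2. *)
Lemma disc_antipode (R : realType) (z c : R[i]) :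
  unit_disc R z -> normc c = 1 -> 2 <= normc (z - c) -> z = - c.
Proof.
rewrite /unit_disc /= => z1 c1 zc.
have := parallelogram z c; rewrite c1 => E.
apply/eqP; rewrite -addr_eq0 -normc_eq0 -sqrf_eq0.
have := sqr_ge0 (normc (z + c)).
have : normc z ^+ 2 <= 1 by rewrite exprn_ile1 ?normc_ge0.
by rewrite eq_le => ? ->; rewrite andbT; nra.
Qed.

(** Halving reduces index [n] to [n / 2].  For [n = 2N], the square [(e n) ^ 2]
    is the point of index [N] of [halve e], so [e n] lies on the circle too.
    For [n = 2N + 1] the quantity to maximize is
    [|node_poly (halve e) N (z ^ 2)| * |z - e (2N)|]; both factors are maximal at [- e (2N)], and the second one only there, so
    that positivity of the first maximum forces [e n = - e (2N)]. *)
Lemma next_max_struct (R : realType) (e : nat -> R[i]) n :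
  normc (e 0%N) = 1 -> (forall k, (k <= n)%N -> next_max e k) ->
  [/\ normc (e n) = 1, 0 < normc (node_poly e n (e n)) &
      odd n -> e n = - e n.-1].
Proof.
elim/ltn_ind: n e => n IHn e e0 eM.
have IHe k : (k < n)%N -> [/\ normc (e k) = 1, 0 < normc (node_poly e k (e k)) &
    odd k -> e k = - e k.-1].
  by move=> kn; apply: IHn => // m mk; apply: eM; lia.
have eN j : (j.*2.+1 < n)%N -> e j.*2.+1 = - e j.*2.
  by move=> jn; have [_ _ ->] := IHe _ jn; rewrite //= odd_double.
have IHF N : (N.*2 <= n)%N -> (N < n)%N -> normc (halve e N) = 1 /\
    0 < normc (node_poly (halve e) N (halve e N)).
  move=> Nn N1; have [] // := IHn N N1 (halve e) _.
    by rewrite /halve normcX e0 expr1n.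
  move=> k kN; apply: next_max_halve; last by apply: eM; lia.
  by move=> j jk; apply: eN; lia.
have [->|n0] := posnP n; first by rewrite /node_poly big_ord0 normc1.
have := odd_double_half n; case: (boolP (odd n)) => _ /= nE; last first.
  move: nE; rewrite add0n; set N := n./2 => nE.
  have [||FN WN] := IHF N; try lia.
  rewrite -nE; split=> //.
  - by apply/eqP; rewrite -(@pexpr_eq1 _ _ 2) ?normc_ge0 // -normcX FN.
  - by rewrite node_poly_halve // => j jN; apply: eN; lia.
move: nE; rewrite add1n; set N := n./2 => nE; rewrite -nE /=.
have [||FN WN] := IHF N; try lia.
have [|eN1 _ _] := IHe N.*2; first by lia.
have antip : e N.*2.+1 = - e N.*2.
  have [e1] := eM n (leqnn n).
  move=> /(_ (- e N.*2)); rewrite /unit_disc /= normcN eN1 => /(_ (lexx _)).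
  rewrite -nE !node_polyS !normcM !(node_poly_halve (N := N)); last 2 first.
    by move=> j jN; apply: eN; lia.
    by move=> j jN; apply: eN; lia.
  rewrite sqrrN => e1M.
  have [_ FM] : next_max (halve e) N.
    apply: next_max_halve; last by apply: eM; lia.
    by move=> j jN; apply: eN; lia.
  have {FM} := FM _ (unit_discX 2 e1); rewrite -nE => FM.
  apply: disc_antipode => //; first by rewrite nE.
  rewrite -(ler_pM2l WN).
  apply: le_trans (le_trans e1M _); last by rewrite ler_wpM2r ?normc_ge0.
  by rewrite /halve -opprD normcN -mulr2n normcMn eN1.
split=> //; first by rewrite antip normcN.
rewrite node_polyS normcM node_poly_halve; last by move=> j jN; apply: eN; lia.
rewrite antip sqrrN mulr_gt0 //.
by rewrite -opprD normcN -mulr2n normcMn eN1.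
Qed.

Lemma leja_norm (R : realType) (e : nat -> R[i]) k : is_leja e -> normc (e k) = 1.
Proof. by case/is_lejaP=> e0 eM; have [] := @next_max_struct _ e k e0. Qed.

Lemma leja_antipodal (R : realType) (e : nat -> R[i]) : is_leja e -> antipodal e.
Proof.
case/is_lejaP=> e0 eM j; have [//|_ _ ->//] := @next_max_struct _ e j.*2.+1 e0.
by rewrite /= odd_double.
Qed.

Lemma leja_halve (R : realType) (e : nat -> R[i]) : is_leja e -> is_leja (halve e).
Proof.
move=> eL; have eA := leja_antipodal eL; case/is_lejaP: eL => e0 eM.
apply/is_lejaP; split; first by rewrite /halve normcX e0 expr1n.
by move=> k; apply: next_max_halve.
Qed.

Lemma leja_node_neq0 (R : realType) (e : nat -> R[i]) k :
  is_leja e -> node_poly e k (e k) != 0.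
Proof.
case/is_lejaP=> e0 eM; have [//|_ + _] := @next_max_struct _ e k e0.
by rewrite lt_def normc_eq0 => /andP[].
Qed.

Lemma leja_inj (R : realType) (e : nat -> R[i]) : is_leja e -> injective e.
Proof.
move=> eL.
have lt_neq i j : (i < j)%N -> e i <> e j.
  move=> ij eij; have /eqP[] := leja_node_neq0 j eL.
  by rewrite /node_poly (bigD1 (Ordinal ij)) //= -eij subrr mul0r.
move=> i j eij; case: (ltngtP i j) => // /lt_neq; first by case.
by move=> h; case: h.
Qed.

(** The maximality at [k] follows from that at [k / 2], since the node polynomial
    is that of [k / 2] points at [z ^ 2], times [z - e (k - 1)] for odd [k],
    which is maximal at the antipode. *)
Lemma antipodal_self_similar_leja (R : realType) (e : nat -> R[i]) :
  normc (e 0%N) = 1 -> antipodal e -> halve e =1 e -> is_leja e.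
Proof.
move=> e0 eA eH; apply/is_lejaP; split=> //.
have eq_np k z : node_poly (halve e) k z = node_poly e k z.
  by apply: eq_bigr => i _; rewrite eH.
have nr k : normc (e k) = 1.
  elim/ltn_ind: k => k IHk; have [->//|k0] := posnP k.
  have ek2 : e k ^+ 2 = e k./2.
    rewrite -(eH k./2) /halve -{1}(odd_double_half k); case: (odd k) => //=.
    by rewrite add1n eA sqrrN.
  by apply/eqP; rewrite -(@pexpr_eq1 _ _ 2) ?normc_ge0 // -normcX ek2 IHk //; lia.
move=> k; split=> [|z z1]; first by rewrite /unit_disc /= nr.
elim/ltn_ind: k z z1 => k IHk z z1.
have [->|k0] := posnP k; first by rewrite /node_poly !big_ord0.
have IHN : normc (node_poly e k./2 (z ^+ 2)) <= normc (node_poly e k./2 (e k./2)).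
  by apply: IHk; [lia | exact: unit_discX].
have := odd_double_half k; case: (odd k) => /=; set N := k./2 in IHN * => <-.
  rewrite add1n !node_polyS !normcM !node_poly_halve // eA sqrrN.
  rewrite !eq_np -[e N.*2 ^+ 2]/(halve e N) eH ler_pM ?normc_ge0 //.
  rewrite -opprD normcN -mulr2n normcMn nr.
  by apply: le_trans (le_normcD _ _) _; rewrite normcN nr mulr2n lerD2r.
by rewrite add0n !node_poly_halve // !eq_np -[e N.*2 ^+ 2]/(halve e N) eH.
Qed.

(** * The bit-reversal sequence *)

Lemma normc_expi (R : realType) (t : R) : normc (expi t) = 1.
Proof. by rewrite /expi /= cos2Dsin2 sqrtr1. Qed.

Lemma expiDpi (R : realType) (t : R) : expi (t + pi) = - expi t.
Proof. by rewrite /expi cosDpi sinDpi. Qed.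

Lemma expi_sqr (R : realType) (t : R) : expi t ^+ 2 = expi (2 * t).
Proof.
rewrite /expi expr2 mulr_natl mulr2n cosD sinD.
by apply/eqP; rewrite eq_complex /= eqxx addrC eqxx.
Qed.

Lemma bdigit0 (b : bool) j : bdigit (b + j.*2) 0 = b.
Proof. by rewrite /bdigit expn0 divn1 oddD odd_double addbF oddb. Qed.

Lemma bdigitS (b : bool) j i : bdigit (b + j.*2) i.+1 = bdigit j i.
Proof.
rewrite /bdigit expnS divnMA; congr (odd (_ %/ _)).
by rewrite divn2 half_bit_double.
Qed.

(** Digits of index at least [k] vanish, so the range of a sum over the digits of
    [k] can be extended at will; this lets [sigma1] and the bit-reversal angle
    be compared for [j] and [2j + b]. *)
Lemma sum_bdigit_widen (V : nmodType) (F : nat -> bool -> V) k n :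
  (forall j, F j false = 0) -> (k <= n)%N ->
  \sum_(j < k) F j (bdigit k j) = \sum_(j < n) F j (bdigit k j).
Proof.
move=> F0 kn; rewrite (big_ord_widen n (fun j => F j (bdigit k j)) kn) [LHS]big_mkcond.
apply: eq_bigr => j _; case: ltnP => // kj.
by rewrite bdigit_small.
Qed.

Lemma sum_bdigit_double (V : nmodType) (F : nat -> bool -> V) (b : bool) j :
  (forall j, F j false = 0) ->
  \sum_(i < b + j.*2) F i (bdigit (b + j.*2) i) =
  F 0%N b + \sum_(i < j) F i.+1 (bdigit j i).
Proof.
move=> F0.
rewrite (@sum_bdigit_widen _ F _ (b + j.*2).+1) // big_ord_recl bdigit0; congr (_ + _).
rewrite (@sum_bdigit_widen _ (fun i => F i.+1) _ (b + j.*2)) //; last by lia.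
by apply: eq_bigr => i _; rewrite lift0 bdigitS.
Qed.

Lemma sigma1_double (b : bool) j : sigma1 (b + j.*2) = (b + sigma1 j)%N.
Proof. exact: (@sum_bdigit_double _ (fun _ => nat_of_bool)). Qed.

(** Prepending the digit [b] to [j] halves the angle and adds [b * pi]: this gives
    antipodality for [b = 1] and self-similarity under squaring for [b = 0]. *)
Lemma bitrev_leja (R : realType) : is_leja (bitrev_seq R).
Proof.
pose G (j : nat) (d : bool) : R := d%:R / 2 ^+ j.
have bE (b : bool) j : bitrev_seq R (b + j.*2) =
    expi (pi * (\sum_(i < j) (bdigit j i)%:R / 2 ^+ i) / 2 + pi * b%:R).
  rewrite /bitrev_seq (@sum_bdigit_double _ G) /G => [|i]; last by rewrite mul0r.
  congr expi; rewrite expr0 divr1 mulrDr addrC -mulrA; congr (_ * _ + _).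
  rewrite mulr_suml; apply: eq_bigr => i _.
  by rewrite exprSr invfM mulrA.
apply: antipodal_self_similar_leja.
- by rewrite /bitrev_seq normc_expi.
- by move=> j; rewrite -[j.*2]add0n -add1n (bE true) (bE false) mulr1 mulr0 addr0 expiDpi.
- move=> j; rewrite /halve -[j.*2]add0n (bE false) expi_sqr mulr0 addr0.
  by rewrite mulrC divfK // pnatr_eq0.
Qed.

(** * The quadratic Lebesgue function *)

Definition quad (R : realType) (e : nat -> R[i]) k z : R :=
  \sum_(j < k) normc (lag e k j z) ^+ 2.

Lemma leja_neq0 (R : realType) (e : nat -> R[i]) k : is_leja e -> e k != 0.
Proof. by move=> eL; rewrite -normc_eq0 leja_norm // oner_neq0. Qed.

(** The two members of a pair contribute [|1 + z / e| ^ 2 + |1 - z / e| ^ 2],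
    which the parallelogram identity makes independent of the pair. *)
Lemma quad_halve (R : realType) (e : nat -> R[i]) N z : is_leja e ->
  quad e N.*2 z = quad (halve e) N (z ^+ 2) * ((1 + normc z ^+ 2) / 2).
Proof.
move=> eL; have eA := leja_antipodal eL; have e0 k := leja_neq0 k eL.
rewrite /quad (big_ord_double _ (fun j => normc (lag e N.*2 j z) ^+ 2)) mulr_suml.
apply: eq_bigr => j _ /=.
rewrite !lag_halve // ?ltn_Sdouble ?ltn_double //.
rewrite doubleK /= uphalf_double !normcM !exprMn -mulrDr; congr (_ * _).
rewrite eA invrN mulrN !normcV normc_nat -mulrDl parallelogram normc1.
by rewrite normcM normcV leja_norm // invr1 mulr1 expr1n; field.
Qed.

Lemma node_poly_lag (R : realType) (e : nat -> R[i]) k j z :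
  injective e -> (j < k)%N ->
  node_poly e k z = (z - e j) * lag e k j z * \prod_(i < k | i != j :> nat) (e j - e i).
Proof.
move=> eI jk; rewrite /node_poly (bigD1 (Ordinal jk)) //= -mulrA /lag prodf_div divfK //.
by apply/prodf_neq0 => i; rewrite subr_eq0 eq_sym => ij; apply: contra ij => /eqP/eI ->.
Qed.

Lemma lag_last (R : realType) (e : nat -> R[i]) k z :
  lag e k.+1 k z = node_poly e k z / node_poly e k (e k).
Proof.
rewrite /lag big_mkcond big_ord_recr /= eqxx mulr1 -prodf_div.
by apply: eq_bigr => i _; rewrite ltn_eqF.
Qed.

(** Newton's form of the update: both sides agree at the [k.+1] nodes. *)
Lemma lagS (R : realType) (e : nat -> R[i]) k j z : injective e -> (j < k)%N ->
  lag e k.+1 j z =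
  lag e k j z - lag e k j (e k) * (node_poly e k z / node_poly e k (e k)).
Proof.
move=> eI jk; have neq i : i != j -> e j - e i != 0.
  by rewrite subr_eq0 eq_sym => ij; apply: contra ij => /eqP/eI ->.
have Wk : node_poly e k (e k) != 0.
  apply/prodf_neq0 => i _; rewrite subr_eq0; apply: contraTneq (ltn_ord i) => /eI <-.
  by rewrite ltnn.
have kj : k != j by rewrite gtn_eqF.
have -> : lag e k.+1 j z = lag e k j z * ((z - e k) / (e j - e k)).
  by rewrite /lag big_mkcond big_ord_recr /= kj -big_mkcond.
have -> : lag e k j (e k) * (node_poly e k z / node_poly e k (e k)) =
    lag e k j z * ((z - e j) / (e k - e j)).
  move: Wk; rewrite !(node_poly_lag _ eI jk); set P := \prod_(i < k | _) _.
  by rewrite !mulf_eq0 !negb_or => /andP[/andP[h1 h2] h3]; field; rewrite h1 h2 h3.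
have h := neq _ kj; have h' : e k - e j != 0 by rewrite -opprB oppr_eq0.
by field; rewrite h h'.
Qed.

(** For [k = 2N + 1] the next point is [- e (2N)], where [node_poly e (2N)] takes
    the same value as at [e (2N)].  The update of [lagS] is then a difference
    [l_j (- e (2N)) - l_j (e (2N))], of the modulus of the halved Lagrange
    polynomial at the next point of [halve e].  Each such value occurs
    twice and the new Lagrange polynomial contributes 1, so the quantity obeys
    [q (2N + 1) = 2 * q N + 1] and [q (2N) = q N], as [2 ^ sigma1 - 1] does. *)
Lemma quad_next (R : realType) (e : nat -> R[i]) k :
  is_leja e -> quad e k (e k) = 2 ^+ sigma1 k - 1.
Proof.
elim/ltn_ind: k e => k IHk e eL; have [->|k0] := posnP k.
  by rewrite /quad /sigma1 !big_ord0 subrr.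
have eA := leja_antipodal eL.
have [b [N kE]] : exists b : bool, exists N, k = (b + N.*2)%N.
  by exists (odd k), k./2; rewrite odd_double_half.
have IHN : quad (halve e) N (halve e N) = 2 ^+ sigma1 N - 1.
  by apply: IHk; [lia | exact: leja_halve].
rewrite {}kE sigma1_double {k k0 IHk}; case: b; last first.
  by rewrite !add0n quad_halve // leja_norm // expr1n -[X in quad _ _ X]/(halve e N) IHN; field.
rewrite !add1n eA /quad big_ord_recr /= lag_last.
have W : node_poly e N.*2 (- e N.*2) = node_poly e N.*2 (e N.*2).
  by rewrite !node_poly_halve // sqrrN.
rewrite W divff ?leja_node_neq0 // normc1 expr1n.
have eI := leja_inj eL.
under eq_bigr => j _.
  rewrite lagS // W divff ?leja_node_neq0 // mulr1 !lag_halve ?leja_neq0 //.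
  rewrite sqrrN -mulrBr.
  have -> : (1 + - e N.*2 / e j) / 2 - (1 + e N.*2 / e j) / 2 = - (e N.*2 / e j).
    by field; rewrite leja_neq0.
  rewrite mulrN normcN !normcM normcV !leja_norm // invr1 !mulr1.
  over.
rewrite (sum_halves N (fun j => normc (lag (halve e) N j (halve e N)) ^+ 2)).
by rewrite -[\sum_(i < N) _]/(quad (halve e) N (halve e N)) IHN exprS; ring.
Qed.

(** The vector of the Lagrange polynomials at [z] is the old one, completed by 0,
    plus the vector of the [- l_j (e k)], completed by 1, multiplied by a scalar
    of modulus at most 1 by the Leja property. *)
Lemma quad_succ (R : realType) (e : nat -> R[i]) k z (A B : R) :
  is_leja e -> unit_disc R z -> 0 <= A -> 0 <= B ->
  quad e k z <= A ^+ 2 -> quad e k (e k) + 1 <= B ^+ 2 ->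
  quad e k.+1 z <= (A + B) ^+ 2.
Proof.
move=> eL z1 A0 B0 zA eB; have eI := leja_inj eL.
(* [lag e k k] is not 0, so the completions have to be explicit. *)
pose a (j : 'I_k.+1) := if (j < k)%N then normc (lag e k j z) else 0.
pose b (j : 'I_k.+1) := if (j < k)%N then normc (lag e k j (e k)) else 1.
have W1 : normc (node_poly e k z / node_poly e k (e k)) <= 1.
  rewrite normcM normcV ler_pdivrMr ?mul1r; last first.
    by rewrite lt_def normc_eq0 leja_node_neq0 // normc_ge0.
  by case/is_lejaP: eL => _ /(_ k)[_]; apply.
apply: le_trans (@Minkowski_sum _ _ a b _ _ A0 B0 _ _).
- apply: ler_sum => j _.
  have ab0 : 0 <= a j + b j by rewrite addr_ge0 // /a /b; case: ifP; rewrite ?normc_ge0 ?ler01.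
  rewrite lerXn2r ?nnegrE ?normc_ge0 // /a /b; case: ltnP => jk.
    rewrite lagS // (le_trans (le_normcD _ _)) // normcN normcM lerD2l.
    by rewrite ler_piMr ?normc_ge0.
  have -> : j = k :> nat by have := ltn_ord j; lia.
  by rewrite lag_last add0r.
- rewrite big_ord_recr /= /a /= ltnn expr0n addr0; apply: le_trans zA.
  by apply: ler_sum => j _; rewrite /= ltn_ord.
- rewrite big_ord_recr /= /b /= ltnn expr1n; apply: le_trans eB.
  by rewrite lerD2r; apply: ler_sum => j _; rewrite /= ltn_ord.
Qed.

(** The right-hand side is the square of the geometric sum of the [sqrt 2 ^ i] for
    [i < sigma1 k]: each one in the binary expansion adds one term, and
    doubling adds none. *)
Lemma quad_growth (R : realType) (e : nat -> R[i]) k z :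
  is_leja e -> unit_disc R z ->
  quad e k z <= ((1 + Num.sqrt 2) * (Num.sqrt 2 ^+ sigma1 k - 1)) ^+ 2.
Proof.
set s : R := Num.sqrt 2; have s2 : s ^+ 2 = 2 by rewrite sqr_sqrtr.
have s1 : 1 <= s by rewrite -(sqrtr1 R) ler_sqrt ?ler1n.
elim/ltn_ind: k e z => k IHk e z eL z1; have [->|k0] := posnP k.
  by rewrite /quad /sigma1 !big_ord0 subrr mulr0 expr0n.
have [b [N kE]] : exists b : bool, exists N, k = (b + N.*2)%N.
  by exists (odd k), k./2; rewrite odd_double_half.
have IHN : quad (halve e) N (z ^+ 2) <= ((1 + s) * (s ^+ sigma1 N - 1)) ^+ 2.
  by apply: IHk; [lia | exact: leja_halve | exact: unit_discX].
rewrite {}kE sigma1_double {k k0 IHk}.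
have IHe : quad e N.*2 z <= ((1 + s) * (s ^+ sigma1 N - 1)) ^+ 2.
  rewrite quad_halve //; apply: le_trans IHN; rewrite ler_piMr //.
    by apply: sumr_ge0 => j _; exact: sqr_ge0.
  have : normc z ^+ 2 <= 1 by rewrite exprn_ile1 ?normc_ge0.
  by lra.
case: b; last by rewrite !add0n.
rewrite !add1n.
have -> : (1 + s) * (s ^+ (sigma1 N).+1 - 1) =
    (1 + s) * (s ^+ sigma1 N - 1) + s ^+ sigma1 N.
  by rewrite exprS; ring: s2.
apply: quad_succ => //.
- by rewrite mulr_ge0 ?subr_ge0 ?exprn_ege1 //; lra.
- by rewrite exprn_ge0 //; lra.
- by rewrite quad_next // -[N.*2]add0n (sigma1_double false) subrK exprAC s2.
Qed.

Lemma quad_le (R : realType) (e : nat -> R[i]) k z :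
  is_leja e -> unit_disc R z -> quad e k z <= 9 * (2 ^+ sigma1 k - 1).
Proof.
move=> eL z1; apply: le_trans (quad_growth k eL z1) _.
set s : R := Num.sqrt 2; have s2 : s ^+ 2 = 2 by rewrite sqr_sqrtr.
have s1 : 1 <= s by rewrite -(sqrtr1 R) ler_sqrt ?ler1n.
rewrite exprMn -s2 exprAC; set x := s ^+ _.
have x1 : 1 <= x by rewrite exprn_ege1.
have s22 : s <= 2 by nra.
(* [(1 + s) ^ 2 = 3 + 2 s <= 9], and [(x - 1) ^ 2 <= x ^ 2 - 1] as [1 <= x]. *)
by apply: ler_pM; rewrite ?sqr_ge0 //; nra.
Qed.

Lemma sum_lag_le (R : realType) (e : nat -> R[i]) k z :
  is_leja e -> unit_disc R z ->
  \sum_(j < k) normc (lag e k j z) <= 3 * Num.sqrt (k%:R * (2 ^+ sigma1 k - 1)).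
Proof.
move=> eL z1.
have s0 : 0 <= \sum_(j < k) normc (lag e k j z) by apply: sumr_ge0 => j _; exact: normc_ge0.
have r0 : 0 <= k%:R * (2 ^+ sigma1 k - 1) :> R.
  by rewrite mulr_ge0 // subr_ge0 exprn_ege1 // ler1n.
rewrite -(@ler_pXn2r _ 2) ?nnegrE ?mulr_ge0 ?sqrtr_ge0 // exprMn sqr_sqrtr //.
have := CauchySchwarz_sum (fun=> 1) (fun j : 'I_k => normc (lag e k j z)).
under eq_bigr do rewrite mul1r.
move/le_trans; apply; rewrite expr1n sumr_const card_ord mulrCA.
by rewrite ler_wpM2l // (le_trans (quad_le k eL z1)) //; lra.
Qed.

(** * Dyadic blocks and roots of unity *)

(** The property of Leja sequences that is inherited by blocks:
    [r |-> e (2 ^ p * j + r)] is in general not Leja, but it is still antipodal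
    at the first [p] levels of halving. *)
Fixpoint dyadic (R : realType) p (e : nat -> R[i]) : Prop :=
  if p is p'.+1 then antipodal e /\ dyadic p' (halve e) else True.

Lemma leja_dyadic (R : realType) p (e : nat -> R[i]) : is_leja e -> dyadic p e.
Proof.
elim: p e => //= p IHp e eL; split; first exact: leja_antipodal.
exact/IHp/leja_halve.
Qed.

Lemma leja_iter_halve (R : realType) p (e : nat -> R[i]) :
  is_leja e -> is_leja (iter p (@halve R) e).
Proof. by move=> eL; elim: p => //= p; exact: leja_halve. Qed.

Lemma halve_block (R : realType) n j (e : nat -> R[i]) :
  halve (fun r => e (n.*2 * j + r)%N) = fun r => halve e (n * j + r)%N.
Proof. by apply/funext => r; rewrite /halve doubleD -!mul2n mulnA. Qed.

Lemma antipodal_block (R : realType) n j (e : nat -> R[i]) :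
  antipodal e -> antipodal (fun r => e (n.*2 * j + r)%N).
Proof. by move=> eA i; rewrite addnS -mul2n -mulnA mul2n -doubleD eA. Qed.

Lemma dyadic_block (R : realType) p j (e : nat -> R[i]) :
  dyadic p e -> dyadic p (fun r => e (2 ^ p * j + r)%N).
Proof.
elim: p e => //= p IHp e [eA eD]; rewrite expnS mul2n.
by split; [exact: antipodal_block | rewrite halve_block; exact: IHp].
Qed.

(** Iterating [lag_halve] [p] times on [e] and on the block of index [j] produces
    the same factors [(1 + z / e i) / 2], so these factors make up the Lagrange
    polynomial of the block. *)
Lemma lag_block (R : realType) p (e : nat -> R[i]) m j r z :
  dyadic p e -> (forall i, e i != 0) -> (j < m)%N -> (r < 2 ^ p)%N ->
  lag e (2 ^ p * m) (2 ^ p * j + r) z =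
  lag (iter p (@halve R) e) m j (z ^+ (2 ^ p)) *
  lag (fun i => e (2 ^ p * j + i)%N) (2 ^ p) r z.
Proof.
elim: p e r z => [|p IHp] e r z.
  rewrite expn0 expr1 !mul1n /= => _ _ _; rewrite ltnS leqn0 => /eqP ->.
  by rewrite addn0 [X in _ * X]/lag [X in _ * X]big_mkcond big_ord1 /= mulr1.
move=> [eA eD] e0 jm; rewrite expnS mul2n => rp.
have -> : ((2 ^ p).*2 * m = (2 ^ p * m).*2)%N by rewrite -!mul2n mulnA.
have half : (((2 ^ p).*2 * j + r)./2 = 2 ^ p * j + r./2)%N.
  by rewrite -mul2n -mulnA mul2n halfD odd_double /= doubleK.
have le1 : ((2 ^ p).*2 * j + r < (2 ^ p * m).*2)%N by nia.
rewrite lag_halve // half iterSr IHp //; last 2 first.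
- by move=> i; rewrite /halve expf_neq0.
- by lia.
rewrite -mulrA -exprM mul2n; congr (_ * _).
by rewrite [in RHS]lag_halve ?halve_block //; exact: antipodal_block.
Qed.

Definition root_seq (R : realType) n j : R[i] := expi (2 * pi * j%:R / n%:R).

Lemma big_ord_halves (N : nat) (F : nat -> nat) :
  (\sum_(i < N.*2) F i = \sum_(i < N) (F i + F (N + i)))%N.
Proof. by rewrite -addnn big_split_ord /= big_split. Qed.

(** For all counting functions [h], hence an equality of multisets.  Both sides are
    sums over antipodal pairs; summing [h] over the two square roots of [y]
    gives a function [H] of [y], and squaring turns both families of [2 ^ p.+1]
    points into the families for [p]. *)
Lemma dyadic_sum (R : realType) p (e : nat -> R[i]) (h : R[i] -> nat) :
  dyadic p e ->
  (\sum_(r < 2 ^ p) h (e r) = \sum_(r < 2 ^ p) h (e 0%N * root_seq R (2 ^ p) r)%R)%N.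
Proof.
elim: p e h => [|p IHp] e h.
  move=> _; rewrite !big_ord1 /root_seq mulr0 mul0r /expi cos0 sin0.
  by rewrite -[Complex _ _]/(1 : R[i]) mulr1.
move=> [eA eD]; rewrite expnS mul2n.
(* [H] does not depend on the choice of the square root. *)
pose H y := (h (sqrtc y) + h (- sqrtc y)%R)%N.
have HE x : (h x + h (- x)%R)%N = H (x ^+ 2).
  have /eqP : (sqrtc (x ^+ 2)) ^+ 2 = x ^+ 2 by rewrite sqr_sqrtc.
  by rewrite eqf_sqr /H => /orP[] /eqP ->; rewrite ?opprK // addnC.
rewrite (big_ord_double _ (fun r => h (e r))).
rewrite (big_ord_halves _ (fun r => h (e 0%N * root_seq R (2 ^ p).*2 r))).
under eq_bigr => r _ do rewrite /= eA HE.
have n0 : (2 ^ p)%:R != 0 :> R by rewrite pnatr_eq0 expn_eq0.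
have rN r : root_seq R (2 ^ p).*2 (2 ^ p + r) = - root_seq R (2 ^ p).*2 r.
  rewrite /root_seq -expiDpi; congr expi; rewrite natrD -muln2 natrM; field; exact: n0.
have rE r : root_seq R (2 ^ p).*2 r ^+ 2 = root_seq R (2 ^ p) r.
  by rewrite /root_seq expi_sqr; congr expi; rewrite -muln2 natrM; field; exact: n0.
rewrite -[LHS]/(\sum_(r < 2 ^ p) H (halve e r))%N (IHp _ H) //.
by apply: eq_bigr => r _; rewrite rN mulrN HE exprMn rE.
Qed.

Lemma dyadic_perm (R : realType) p (e : nat -> R[i]) : dyadic p e ->
  perm_eq (mkseq e (2 ^ p)) (mkseq (fun r => e 0%N * root_seq R (2 ^ p) r) (2 ^ p)).
Proof.
move=> eD; apply/permP => a.
have cE (f : nat -> R[i]) n : count a (mkseq f n) = (\sum_(r < n) a (f r))%N.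
  rewrite -sum1_count big_map -{1}[n]subn0 -/(index_iota 0 n) big_mkord big_mkcond.
  by apply: eq_bigr => i _; case: (a _).
by rewrite !cE (dyadic_sum (fun x => a x : nat) eD).
Qed.

(** The Lebesgue function of a sequence of points.  Being invariant under
    permutation, it forgets the order in which the roots of unity occur. *)
Definition lebesgue_seq (R : realType) (s : seq R[i]) z : R :=
  \sum_(x <- s) normc (\prod_(y <- s | y != x) ((z - y) / (x - y))).

Lemma lebesgue_seq_perm (R : realType) (s t : seq R[i]) z :
  perm_eq s t -> lebesgue_seq s z = lebesgue_seq t z.
Proof.
move=> st; rewrite /lebesgue_seq (perm_big _ st); apply: eq_bigr => x _.
by rewrite (perm_big _ st).
Qed.

Lemma lebesgue_seq_mkseq (R : realType) (f : nat -> R[i]) n z :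
  uniq (mkseq f n) -> lebesgue_seq (mkseq f n) z = \sum_(j < n) normc (lag f n j z).
Proof.
move/mkseq_uniqP => fI; rewrite /lebesgue_seq /mkseq big_map.
rewrite -{1}[n]subn0 -/(index_iota 0 n) big_mkord; apply: eq_bigr => j _.
congr normc; rewrite big_map -{1}[n]subn0 -/(index_iota 0 n) big_mkord.
by apply: eq_bigl => i; rewrite (inj_in_eq fI) ?inE.
Qed.

Lemma lag_scale (R : realType) (f : nat -> R[i]) c n j z : c != 0 ->
  lag (fun i => c * f i) n j z = lag f n j (z / c).
Proof.
move=> c0; apply: eq_bigr => i _.
have -> : z - c * f i = c * (z / c - f i) by field.
by rewrite -mulrBr -mulf_div divff // mul1r.
Qed.

Lemma lebesgue_fun_le (R : realType) k (S : 'I_k -> R[i]) z :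
  unit_disc R z -> lebesgue_fun S z <= lebesgue_const S.
Proof. by move=> z1; have [w _ [<-]] := lebesgue_const_max S; apply. Qed.

Lemma dyadic_lebesgue_le (R : realType) p (e : nat -> R[i]) z :
  dyadic p e -> injective e -> normc (e 0%N) = 1 -> unit_disc R z ->
  \sum_(r < 2 ^ p) normc (lag e (2 ^ p) r z) <= lebesgue_const (unity_roots R (2 ^ p)).
Proof.
move=> eD eI e1 z1; have e0 : e 0%N != 0 by rewrite -normc_eq0 e1 oner_neq0.
have eU : uniq (mkseq e (2 ^ p)) by apply/mkseq_uniqP => i j _ _; exact: eI.
have eP := dyadic_perm eD.
rewrite -lebesgue_seq_mkseq // (lebesgue_seq_perm _ eP).
rewrite lebesgue_seq_mkseq -?(perm_uniq eP) //.
under eq_bigr do rewrite lag_scale //.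
apply: (@lebesgue_fun_le _ _ (unity_roots R (2 ^ p)) (z / e 0%N)).
by rewrite /unit_disc /= normcM normcV e1 invr1 mulr1.
Qed.

Lemma sum_block (V : nmodType) n m (F : nat -> V) :
  \sum_(i < n * m) F i = \sum_(j < m) \sum_(r < n) F (n * j + r)%N.
Proof.
elim: m => [|m IHm]; first by rewrite muln0 !big_ord0.
by rewrite mulnS addnC big_split_ord /= IHm big_ord_recr.
Qed.

Lemma leja_block_lebesgue (R : realType) p (e : nat -> R[i]) m z :
  is_leja e -> unit_disc R z ->
  \sum_(i < 2 ^ p * m) normc (lag e (2 ^ p * m) i z) <=
  (\sum_(j < m) normc (lag (iter p (@halve R) e) m j (z ^+ (2 ^ p)))) *
  lebesgue_const (unity_roots R (2 ^ p)).
Proof.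
move=> eL z1; have eD := leja_dyadic p eL.
rewrite (sum_block _ _ (fun i => normc (lag e (2 ^ p * m) i z))) mulr_suml.
apply: ler_sum => j _.
have e0 i : e i != 0 by exact: leja_neq0.
under eq_bigr => r _ do rewrite lag_block // normcM.
rewrite -mulr_sumr ler_wpM2l ?normc_ge0 //.
apply: dyadic_lebesgue_le => //; first exact: dyadic_block.
- by move=> i1 i2 /(leja_inj eL) /addnI.
- exact: leja_norm.
Qed.

(** * The bound *)

Lemma sigma1_pow2 p m : sigma1 (2 ^ p * m) = sigma1 m.
Proof.
elim: p => [|p IHp]; first by rewrite expn0 mul1n.
by rewrite expnS -mulnA mul2n -[_.*2]add0n (sigma1_double false) IHp.
Qed.

Unset Implicit Arguments.

Theorem theorem2p9 (R : realType) (e : nat -> R[i])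
    (he : (forall k : nat, e k = bitrev_seq R k) \/ is_leja e)
    (k : nat) (hk : (0 < k)%N) :
  lebesgue_const (initial_section e k) <=
  3 * Num.sqrt (k%:R / 2 ^+ logn 2 k * (2 ^+ sigma1 k - 1)) *
  lebesgue_const (unity_roots R (2 ^ logn 2 k)).
Proof.
have eL : is_leja e.
  by case: he => // eE; have -> : e = bitrev_seq R by [apply/funext]; exact: bitrev_leja.
have [z z1 [<- _]] := lebesgue_const_max (initial_section e k).
rewrite -/(\sum_(j < k) normc (lag e k j z)).
set p := logn 2 k; have [m kE] : exists m, k = (2 ^ p * m)%N.
  by have /dvdnP[m] := pfactor_dvdnn 2 k; exists m; rewrite mulnC.
rewrite kE sigma1_pow2 natrM natrX [_ * m%:R]mulrC mulfK ?expf_neq0 ?pnatr_eq0 //.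
have L0 : 0 <= lebesgue_const (unity_roots R (2 ^ p)).
  apply: le_trans (lebesgue_fun_le (unity_roots R (2 ^ p)) z1).
  by apply: sumr_ge0 => j _; exact: normc_ge0.
apply: le_trans (leja_block_lebesgue _ _ eL z1) _.
rewrite ler_wpM2r // sum_lag_le //; first exact: leja_iter_halve.
exact: unit_discX.
Qed.
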